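(* For all integers $\alpha\ge0$ and $n\ge0$, $$p_{7,7}\left(2 \cdot 7^{2 \alpha+1} n+\frac{(11+12 r) \cdot 49^{\alpha}-5}{6}\right) \equiv 0\pmod 2\quad\text{for } r\in\{3,4,6\},$$ and $$p_{7,7}\left(2 \cdot 49^{\alpha+1} n+\frac{(12 s+5) \cdot 7^{2 \alpha+1}-5}{6}\right) \equiv 0\pmod 2\quad\text{for } s\in\{2,4,5\}.$$
   Context: For a partition $\lambda$, $\mathrm{mex}_{7,7}(\lambda)$ is the smallest positive multiple of $7$ that is not a part of $\lambda$; $p_{7,7}(n)$ is the number of partitions $\lambda$ of $n$ with $\mathrm{mex}_{7,7}(\lambda)\equiv 7 \pmod{14}$. *)

(* Defs.v *)
From mathcomp Require Import all_boot.

Set Implicit Arguments.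
Unset Strict Implicit.
Unset Printing Implicit Defensive.

Definition is_partition (n : nat) (s : seq nat) : bool :=
  [&& sorted geq s, 0 \notin s & sumn s == n].

Definition missing_mult7 (s : seq nat) : pred nat :=
  [pred m | [&& 0 < m, 7 %| m & m \notin s]].

Lemma missing_mult7_ex (s : seq nat) : exists m, missing_mult7 s m.
Proof.
exists (7 * (sumn s).+1); apply/and3P; split=> //; first exact: dvdn_mulr.
apply/negP => /(nthP 0) [i lt_i eq_i].
have : nth 0 s i <= sumn s.
  by rewrite sumnE (big_nth 0) big_mkord (bigD1 (Ordinal lt_i)) //= leq_addr.
by rewrite eq_i leqNgt (leq_trans (ltnSn _)) // leq_pmull.
Qed.

Definition mex77 (s : seq nat) : nat := ex_minn (missing_mult7_ex s).

(* A partition of n has at most n parts, each at most n, so the partitions of n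
   are exactly the elements of the finite type {bseq n of 'I_n.+1} satisfying
   [is_partition n]. *)
Definition p77 (n : nat) : nat :=
  #|[set s : {bseq n of 'I_n.+1} |
       let l := [seq nat_of_ord i | i <- s] in
       is_partition n l && (mex77 l == 7 %[mod 14])]|.

(* Main.v *)
Require Import Defs.
From mathcomp Require Import all_boot all_algebra.
From mathcomp Require Import zify ring.

(** Modulo 2, with f = prod (1 - q^i) and psi(q) = sum_(s >= 0) q^(s(s+1)/2),
    inclusion-exclusion on the parts 7, 14, 21, ... shows that
    G = sum p77(n) q^n equals psi(q^7) / f.  Gauss's identity gives f^3 = psi(q),
    so f^4 G = psi(q) psi(q^7).  In characteristic 2 the derivative keeps the odd
    coefficients and the square r^2 is r(q^2).  Multiplication by
    (1 + sqrt(-7)) / 2 matches the solutions of x^2 + 7 y^2 = M in odd x, y with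
    those of x^2 + 7 y^2 = 2 M whenever 8 divides M, which says
    (psi(q) psi(q^7))' = (psi(q) psi(q^7))^2.  Hence G' = (f psi(q^7))^2, that is,
    p77(2n+1) is the coefficient of q^n in f psi(q^7).  By the pentagonal number
    theorem this coefficient vanishes unless 24 n + 22 = x^2 + 21 y^2, and a
    descent modulo 7 rules this out for the given arguments. *)

Import GRing.Theory.

(** * Triangular numbers *)

Definition tri (s : nat) : nat := (s * s.+1)./2.
Arguments tri : simpl never.

Lemma triS s : tri s.+1 = (tri s + s.+1)%N.
Proof. by rewrite /tri mulSn mulnC; have := odd_halfK; lia. Qed.

Lemma tri2 s : ((tri s).*2 = s * s.+1)%N.
Proof. by elim: s => [|s IHs] //; rewrite triS doubleD IHs; lia. Qed.

(** * Solutions of x^2 + 7 y^2 = M *)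

(** With x = 2a + 1 and y = 2b + 1 the condition reads x^2 + 7 y^2 = 8 (i + 1). Since a <= [tri a],
    any bound [m] above [i] catches all solutions. *)
Definition tri_reps (m i : nat) : seq (nat * nat) :=
  [seq p <- [seq (a, b) | a <- iota 0 m, b <- iota 0 m]
  | tri p.1 + 7 * tri p.2 == i].

Lemma tri_reps_uniq m i : uniq (tri_reps m i).
Proof.
apply: filter_uniq; apply: allpairs_uniq; rewrite ?iota_uniq //.
by case=> a b [a' b'].
Qed.

Lemma leq_tri a : a <= tri a.
Proof. by have := tri2 a; nia. Qed.

Lemma mem_tri_reps m i a b :
  i < m -> ((a, b) \in tri_reps m i) = (tri a + 7 * tri b == i).
Proof.
move=> lt_im; rewrite mem_filter andbC /=; case: eqP => [def_i|]; last by rewrite andbF.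
rewrite andbT; apply/allpairsP; exists (a, b); rewrite !mem_iota !add0n /=.
by have := leq_tri a; have := leq_tri b; split=> //; lia.
Qed.

(* In terms of x = 2a + 1 and y = 2b + 1, the numbers |u| and |v| with
   u + v sqrt(-7) = (x + y sqrt(-7)) (1 +- sqrt(-7)) / 2, the sign being the
   one that makes u and v odd. *)
Definition tri_double (p : nat * nat) : nat * nat :=
  let: (a, b) := p in
  if odd a == odd b then
    ((if 7 * b + 3 < a then a - (7 * b + 4) else 7 * b + 2 - a)./2, (a + b)./2)
  else ((a + 7 * b + 3)./2, ((if b < a then a - b else b - a).-1)./2).

Lemma odd_tri u : odd (tri u) = ((u %% 4 == 1) || (u %% 4 == 2)).
Proof.
have := tri2 u; rewrite {2 3}(divn_eq u 4); have : u %% 4 < 4 by rewrite ltn_mod.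
by move: (u %/ 4) (u %% 4) => k [|[|[|[|[]]]]] //= _ e; lia.
Qed.

Lemma tri_normE a b u v :
  ((2%:Z * u%:Z + 1) ^+ 2 + 7%:Z * (2%:Z * v%:Z + 1) ^+ 2 =
   2%:Z * ((2%:Z * a%:Z + 1) ^+ 2 + 7%:Z * (2%:Z * b%:Z + 1) ^+ 2))%R ->
  tri u + 7 * tri v = 2 * (tri a + 7 * tri b) + 1.
Proof.
by have [[ta tb] [tu tv]] := ((tri2 a, tri2 b), (tri2 u, tri2 v)); nia.
Qed.

Lemma tri_double_norm a b u v : tri_double (a, b) = (u, v) ->
  tri u + 7 * tri v = 2 * (tri a + 7 * tri b) + 1.
Proof.
rewrite /tri_double => eq_uv; apply: tri_normE.
case: (odd a =P odd b) eq_uv => o; case: ifP => lt [eu ev].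
(* Up to sign, the right-hand sides are the coordinates of the product defining [tri_double]; what
   remains is multiplicativity of the norm. *)
- have -> : (2%:Z * u%:Z + 1 = a%:Z - 7%:Z * b%:Z - 3%:Z)%R by lia.
  have -> : (2%:Z * v%:Z + 1 = a%:Z + b%:Z + 1)%R by lia.
  ring.
- have -> : (2%:Z * u%:Z + 1 = - (a%:Z - 7%:Z * b%:Z - 3%:Z))%R by lia.
  have -> : (2%:Z * v%:Z + 1 = a%:Z + b%:Z + 1)%R by lia.
  ring.
- have -> : (2%:Z * u%:Z + 1 = a%:Z + 7%:Z * b%:Z + 4%:Z)%R by lia.
  have -> : (2%:Z * v%:Z + 1 = a%:Z - b%:Z)%R by lia.
  ring.
- have -> : (2%:Z * u%:Z + 1 = a%:Z + 7%:Z * b%:Z + 4%:Z)%R by lia.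
  have -> : (2%:Z * v%:Z + 1 = - (a%:Z - b%:Z))%R by lia.
  ring.
Qed.

(** With U = 2u + 1 and V = 2v + 1, dividing by (1 +- sqrt(-7)) / 2 gives the second coordinate (V
    -+ U) / 4. The hypothesis forces u - v = 2 or u + v = 1 modulo 4, so for one sign this is an odd
    integer, of absolute value 2b + 1. *)
Lemma tri_double_surj u v :
  odd (tri u + 7 * tri v) -> exists p, tri_double p = (u, v).
Proof.
rewrite oddD oddM /= !odd_tri => o_uv.
case: (odd u =P odd v) => o.
  have [lt_uv | le_vu] := ltnP u v.
    have [b def_v] : exists b, v = u + 4 * b + 2 by exists ((v - u - 2) %/ 4); lia.
    exists (2 * u + 7 * b + 4, b); rewrite {o_uv o lt_uv}def_v /tri_double.
    case: eqP => o; last by lia.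
    case: ifP => ?; congr pair; lia.
  have [b def_u] : exists b, u = v + 4 * b + 2 by exists ((u - v - 2) %/ 4); lia.
  exists (2 * v + b + 1, b); rewrite {o_uv o le_vu}def_u /tri_double.
  case: eqP => o; first by lia.
  by case: ifP => ?; congr pair; lia.
have [b def_uv] : exists b, u + v = 4 * b + 1 by exists ((u + v - 1) %/ 4); lia.
clear o_uv o; have [lt_vu | le_uv] := ltnP (7 * v + 3) u.
  exists (b - 2 * v - 1, b); rewrite /tri_double.
  case: eqP => o; first by lia.
  by case: ifP => ?; congr pair; lia.
exists (2 * v - b, b); rewrite /tri_double.
case: eqP => o; last by lia.
by case: ifP => ?; congr pair; lia.
Qed.

(** [tri_double] is a bijection from the solutions for M = 8 (n + 1) to those for 2 M = 8 ((2n + 1)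
    + 1). *)
Lemma size_tri_reps_double m n :
  2 * n + 1 < m -> size (tri_reps m (2 * n + 1)) = size (tri_reps m n).
Proof.
move=> lt_m; rewrite -(size_map tri_double (tri_reps m n)); apply: perm_size.
have lt_nm : n < m by lia.
apply: uniq_perm; first exact: tri_reps_uniq.
  rewrite map_inj_in_uniq ?tri_reps_uniq // => -[a b] [a' b'] _ _.
  rewrite /tri_double.
  case: (odd a =P odd b); case: (odd a' =P odd b') => o' o; repeat case: ifP => ?;
    case=> e1 e2; congr pair; lia.
case=> u v; rewrite mem_tri_reps //; apply/eqP/mapP => [def_n | [[a b]]].
  have [|[a b] def_uv] := tri_double_surj u v; first by rewrite def_n; lia.
  exists (a, b); rewrite ?def_uv // mem_tri_reps //.
  by have := tri_double_norm _ _ _ _ def_uv; lia.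
rewrite mem_tri_reps // => /eqP <- /esym; exact: tri_double_norm.
Qed.

(** * Partitions *)

(** Plain sequences allow parts to be added and removed without the bounds of the finite type. *)
Definition parts (n : nat) : seq (seq nat) :=
  [seq l <- [seq map (@nat_of_ord n.+1) (val s) | s <- enum {: {bseq n of 'I_n.+1}}]
  | is_partition n l].

Lemma map_ord_bseq_inj n :
  injective (fun s : {bseq n of 'I_n.+1} => map (@nat_of_ord n.+1) (val s)).
Proof. by move=> s t /(inj_map val_inj) /val_inj. Qed.

Lemma parts_uniq n : uniq (parts n).
Proof.
apply: filter_uniq; rewrite map_inj_uniq ?enum_uniq //; exact: map_ord_bseq_inj.
Qed.

Lemma leq_sumn_mem (s : seq nat) x : x \in s -> x <= sumn s.
Proof.
elim: s => //= y s IHs; rewrite inE => /predU1P[-> | /IHs le_x]; first exact: leq_addr.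
exact: leq_trans le_x (leq_addl _ _).
Qed.

Lemma leq_size_sumn (s : seq nat) : 0 \notin s -> size s <= sumn s.
Proof. by elim: s => //= x s IHs; rewrite inE negb_or => /andP[x0 /IHs]; lia. Qed.

Lemma mem_parts n l : (l \in parts n) = is_partition n l.
Proof.
rewrite mem_filter andb_idr // => /and3P[_ l_pos /eqP sum_l].
have size_l : size (map (@inord n) l) <= n by rewrite size_map -sum_l leq_size_sumn.
apply/mapP; exists (Bseq size_l); first by rewrite mem_enum.
rewrite /= -map_comp -[LHS]map_id; apply/eq_in_map => x l_x /=.
by rewrite inordK // ltnS -sum_l leq_sumn_mem.
Qed.

Lemma p77E n : p77 n = count (fun l => mex77 l == 7 %[mod 14]) (parts n).
Proof.
rewrite /p77 cardsE cardE /enum_mem size_filter /parts count_filter count_map.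
by rewrite enumT; apply: eq_count => s /=; rewrite andbC.
Qed.

Definition npart (m n : nat) : nat := count (all (leq^~ m)) (parts n).

Lemma npart_geq m n : n <= m -> npart m n = size (parts n).
Proof.
move=> le_nm; rewrite -count_predT; apply: eq_in_count => l.
rewrite mem_parts => /and3P[_ _ /eqP sum_l]; apply/allP => x l_x.
by apply: leq_trans le_nm; rewrite -sum_l leq_sumn_mem.
Qed.

Lemma npart0 n : npart 0 n = (n == 0).
Proof.
rewrite /npart; case: eqP => [-> | n_neq0].
  rewrite -size_filter (perm_size (_ : perm_eq _ [:: [::]])) //.
  apply: uniq_perm => //; first by rewrite filter_uniq ?parts_uniq.
  move=> l; rewrite mem_filter mem_parts inE; case: l => //= x l.
  by rewrite leqn0; case: eqP => // ->; rewrite /is_partition inE eqxx /= !andbF.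
apply/eqP; rewrite -leqn0 leqNgt -has_count; apply/hasPn => -[|x l].
  by rewrite mem_parts => /and3P[_ _ /eqP] /=; lia.
rewrite mem_parts => /and3P[_]; rewrite inE negb_or => /andP[x_neq0 _] _ /=.
by rewrite leqn0 eq_sym (negPf x_neq0).
Qed.

(** Split by whether m + 1 is a part. If so, it heads the weakly decreasing sequence and can be
    removed. The guard m < n protects the truncated subtraction. *)
Lemma npartS m n :
  npart m.+1 n = npart m n + (if m < n then npart m.+1 (n - m.+1) else 0).
Proof.
pose bigger := if m < n then
  [seq m.+1 :: l | l <- parts (n - m.+1) & all (leq^~ m.+1) l] else [::].
have -> : (if m < n then npart m.+1 (n - m.+1) else 0) = size bigger.
  by rewrite /bigger; case: ifP; rewrite // size_map size_filter.
rewrite /npart -!size_filter -size_cat; apply: perm_size; apply: uniq_perm.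
- by rewrite filter_uniq ?parts_uniq.
- rewrite cat_uniq filter_uniq ?parts_uniq //= /bigger; case: ifP => lt_mn //=.
  rewrite map_inj_uniq ?(filter_uniq _ (parts_uniq _)) ?andbT; last by move=> ? ? [].
  apply/hasPn => _ /mapP[l _ ->]; rewrite mem_filter /=.
  by rewrite ltnn.
move=> l; rewrite mem_cat mem_filter [in RHS]mem_filter !mem_parts; apply/andP/orP.
  case=> le_l part_l; have [le_lm | /allPn[x l_x]] := boolP (all (leq^~ m) l).
    by left.
  rewrite -ltnNge => lt_mx; right; case: l => // y l in l_x le_l part_l *.
  have def_y : y = m.+1.
    have /andP[le_y _] := le_l; case/and3P: part_l => sort_l _ _.
    apply/eqP; rewrite eqn_leq le_y (leq_trans lt_mx) //.
    move: l_x; rewrite inE => /predU1P[-> // | l_x].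
    by have /allP/(_ _ l_x) := order_path_min (rev_trans leq_trans) sort_l.
  rewrite {y}def_y in l_x le_l part_l *; rewrite /bigger.
  case/and3P: part_l => /= sort_l; rewrite inE => /norP[_ l_pos] /eqP sum_l.
  have -> : m < n by lia.
  have le_l' : all (leq^~ m.+1) l by case/andP: le_l.
  apply: map_f; rewrite mem_filter mem_parts le_l' /=.
  by rewrite /is_partition (path_sorted sort_l) l_pos; apply/eqP; lia.
case=> [/andP[/allP le_l ->]|].
  by split=> //; apply/allP => x /le_l /leqW.
rewrite /bigger; case: ifP => // lt_mn /mapP[l']; rewrite mem_filter mem_parts.
case/andP=> le_l /and3P[sort_l l_pos /eqP sum_l] ->; split=> /=; first by rewrite leqnn.
rewrite /is_partition /= inE eq_sym /= l_pos.
rewrite (path_min_sorted _) ?sort_l //=; apply/eqP; lia.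
Qed.

Lemma uniq_all_mem_perm (T : eqType) (c l : seq T) :
  uniq c -> all (mem l) c -> exists l', perm_eq l (l' ++ c).
Proof.
move=> c_uniq /allP c_l.
have [|l1 sub_l1 perm_c] := (count_subseqP c l).1.
  move=> x; rewrite count_uniq_mem //; case: (boolP (x \in c)) => // /c_l l_x.
  by rewrite -has_count has_pred1.
have [l' perm_l] := perm_to_subseq sub_l1; exists l'.
by rewrite (permPl perm_l) perm_catC perm_cat2l perm_sym.
Qed.

(** Deleting one copy of each element of [c] is inverse to merging [c] into a partition of n -
    [sumn c] and sorting. *)
Lemma count_parts_superset (c : seq nat) n :
  uniq c -> 0 \notin c ->
  count (fun l => all (mem l) c) (parts n) =
  if sumn c <= n then size (parts (n - sumn c)) else 0.
Proof.
move=> c_uniq c_pos; have geq_tr : transitive geq := rev_trans leq_trans.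
have geq_anti : antisymmetric geq by move=> x y; rewrite andbC => /anti_leq.
have geq_total : total geq by move=> x y; exact: leq_total.
case: ifP => [le_cn | lt_nc]; last first.
  apply/eqP; rewrite -leqn0 leqNgt -has_count; apply/hasPn => l; rewrite mem_parts.
  case/and3P=> _ _ /eqP sum_l; apply/negP => /(uniq_all_mem_perm _ _ _ c_uniq).
  by case=> l' /perm_sumn; rewrite sumn_cat; lia.
rewrite -(size_map (fun l => sort geq (l ++ c))) -size_filter.
apply: perm_size; apply: uniq_perm.
- by rewrite filter_uniq ?parts_uniq.
- rewrite map_inj_in_uniq ?parts_uniq // => l l'; rewrite !mem_parts.
  case/and3P=> sort_l _ _ /and3P[sort_l' _ _] eq_s.
  apply: (sorted_eq geq_tr geq_anti) => //.
  by rewrite -(perm_cat2r c) -(perm_sort geq) eq_s perm_sort.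
move=> l; rewrite mem_filter mem_parts; apply/andP/mapP.
  case=> /(uniq_all_mem_perm _ _ _ c_uniq)[l' perm_l] /and3P[sort_l l_pos /eqP sum_l].
  have perm_sl : perm_eq l (sort geq l' ++ c).
    by rewrite (permPl perm_l) perm_cat2r perm_sym perm_sort.
  exists (sort geq l').
    rewrite mem_parts /is_partition sort_sorted // mem_sort.
    have := perm_sumn perm_sl; rewrite sumn_cat sum_l => ->; rewrite addnK eqxx andbT.
    by move: l_pos; rewrite (perm_mem perm_l) mem_cat => /norP[].
  apply: (sorted_eq geq_tr geq_anti); rewrite ?sort_sorted //.
  by rewrite (permPl perm_sl) perm_sym perm_sort.
case=> l'; rewrite mem_parts => /and3P[sort_l l_pos /eqP sum_l] ->; split.
  by apply/allP => x c_x; rewrite inE mem_sort mem_cat c_x orbT.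
rewrite /is_partition sort_sorted // mem_sort mem_cat negb_or l_pos c_pos /=.
have /permPl/perm_sumn -> := perm_sort geq (l' ++ c).
by rewrite sumn_cat; apply/eqP; lia.
Qed.

(** * Parts divisible by 7 and the parity of [p77] *)

Definition mult7 (j : nat) : seq nat := [seq 7 * i | i <- iota 1 j].

Lemma mult7_uniq j : uniq (mult7 j).
Proof. by rewrite map_inj_uniq ?iota_uniq // => x y; lia. Qed.

Lemma mult7_pos j : 0 \notin mult7 j.
Proof. by apply/mapP => -[i]; rewrite mem_iota; lia. Qed.

Lemma sumn_mult7 j : sumn (mult7 j) = 7 * tri j.
Proof.
elim: j => // j IHj.
by rewrite /mult7 -[in iota _ _](addn1 j) iotaD map_cat sumn_cat -/(mult7 j) IHj /= triS; lia.
Qed.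

Lemma mult7_subset_mex (l : seq nat) j : all (mem l) (mult7 j) = (7 * j < mex77 l).
Proof.
rewrite /mex77; case: ex_minnP => m /and3P[m_gt0 /dvdnP[k def_m] m_l] m_min.
apply/allP/idP => [sub_l | lt_jm x /mapP[i]].
  rewrite ltnNge; apply/negP => le_mj; case/negP: m_l; apply: sub_l.
  by apply/mapP; exists k; rewrite ?mem_iota; lia.
rewrite mem_iota => i_range -> /=; apply: contraTT lt_jm => li.
have := m_min (7 * i); rewrite /missing_mult7 /= li dvdn_mulr // andbT /=; lia.
Qed.

(** If the mex is 7 (k + 1), the summand is 1 exactly for j <= k, so the sum is k + 1. The range
    reaches k because 7k is 0 or a part of [l]. *)
Lemma mex77_odd n m l : l \in parts n -> n < m ->
  (mex77 l == 7 %[mod 14]) = odd (\sum_(j < m) all (mem l) (mult7 j)).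
Proof.
rewrite mem_parts => /and3P[_ _ /eqP sum_l] lt_nm.
have [k def_mex] : exists k, mex77 l = 7 * k.+1.
  rewrite /mex77; case: ex_minnP => x /and3P[x_gt0 /dvdnP[k def_x] _] _.
  by exists k.-1; lia.
have lt_km : k < m.
  apply: leq_ltn_trans lt_nm; have := mult7_subset_mex l k.
  rewrite def_mex ltn_pmul2l // ltnSn; case: k {def_mex} => // k /allP sub_l.
  have /leq_sumn_mem : 7 * k.+1 \in l.
    by apply: sub_l; apply: map_f; rewrite mem_iota; lia.
  by rewrite sum_l; lia.
rewrite (eq_bigr (fun j : 'I_m => nat_of_bool (j < k.+1))); last first.
  by move=> j _; rewrite mult7_subset_mex def_mex ltn_pmul2l.
rewrite -(big_mkord xpredT (fun j => nat_of_bool (j < k.+1))).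
rewrite (big_cat_nat (n := k.+1)) //= [X in _ + X]big_nat_cond [X in _ + X]big1 ?addn0; last first.
  by move=> j /andP[/andP[le_kj _] _]; rewrite ltnNge le_kj.
rewrite big_nat_cond (eq_bigr (fun=> 1)); last first.
  by move=> j /andP[/andP[_ ->] _].
rewrite -big_nat_cond sum_nat_const_nat; lia.
Qed.

(** Sum [mex77_odd] over all partitions of n and exchange the sums. The result is the coefficient of
    q^n in psi(q^7) / f. *)
Lemma odd_p77 n m : n < m ->
  odd (p77 n) = odd (\sum_(j < m | 7 * tri j <= n) size (parts (n - 7 * tri j))).
Proof.
move=> lt_nm; rewrite p77E -sumn_count sumnE big_map big_seq.
rewrite (big_morph odd oddD (erefl : odd 0 = false)).
under eq_bigr => l part_l do rewrite oddb (mex77_odd n m l part_l lt_nm).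
rewrite -(big_morph odd oddD (erefl : odd 0 = false)) -big_seq exchange_big /=.
rewrite [in RHS]big_mkcond /=; congr odd; apply: eq_bigr => j _.
rewrite -sumn_mult7 -count_parts_superset ?mult7_uniq ?mult7_pos //.
by rewrite -sumn_count sumnE big_map.
Qed.

(** * Finite forms of the theorems of Euler and Gauss *)

Local Open Scope ring_scope.

Section FiniteIdentities.

Variables (R : comPzRingType) (q : R).

(** The quotient (q;q)_n / (q;q)_m for m <= n, written without division. *)
Definition qprod m n : R := \prod_(m <= i < n) (1 - q ^+ i.+1).

Lemma qprod_recl m n : (m < n)%N -> qprod m n = (1 - q ^+ m.+1) * qprod m.+1 n.
Proof. by move=> lt_mn; rewrite /qprod big_ltn. Qed.

Lemma qprod_recr m n : (m <= n)%N -> qprod m n.+1 = qprod m n * (1 - q ^+ n.+1).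
Proof. by move=> le_mn; rewrite /qprod big_nat_recr. Qed.

Lemma qprodnn n : qprod n n = 1.
Proof. by rewrite /qprod big_geq. Qed.

(** Shanks's finite form of Euler's pentagonal number theorem; the exponents on the right are k(3k +
    1)/2 and k(3k - 1)/2 with k = s + 1. *)
Lemma shanks_pentagonal n :
  \sum_(s < n.+1) (-1) ^+ s * qprod s n * q ^+ (s * n + tri s) =
  1 + \sum_(s < n) (-1) ^+ s.+1 * (q ^+ (s.+1 * s.+1 + tri s.+1) +
                                   q ^+ (s.+1 * s + tri s.+1)).
Proof.
elim: n => [|n IHn]; first by rewrite big_ord1 big_ord0 qprodnn /= !mulr1 addr0.
(* Passing from n to n + 1 changes each partial sum by a single boundary term. *)
have partial k : (k <= n)%N ->
  \sum_(s < k.+1) (-1) ^+ s * qprod s n.+1 * q ^+ (s * n.+1 + tri s) =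
  \sum_(s < k.+1) (-1) ^+ s * qprod s n * q ^+ (s * n + tri s) +
  (-1) ^+ k.+1 * qprod k n * q ^+ (k.+1 * n + tri k.+1).
  elim: k => [|k IHk] le_kn.
    by rewrite !big_ord1 /= qprod_recr // !mul0n mul1n add0n addn1; ring.
  rewrite big_ord_recr [in RHS]big_ord_recr /= {}IHk; last exact: ltnW.
  rewrite qprod_recl // qprod_recr //.
  have -> : (k.+1 * n.+1 + tri k.+1 = k.+1 + (k.+1 * n + tri k.+1))%N by lia.
  have -> : (k.+2 * n + tri k.+2 = k.+1 + n.+1 + (k.+1 * n + tri k.+1))%N.
    by rewrite (triS k.+1); lia.
  by rewrite !exprD !exprS; ring.
rewrite big_ord_recr /= partial // IHn [in RHS]big_ord_recr /= qprodnn.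
by rewrite mulr1 qprodnn; ring.
Qed.

End FiniteIdentities.

(** Shanks's finite form of Gauss's identity, cleared of the denominator [odds n]. As n grows only
    the term s = 0 survives on the left. *)
Lemma shanks_gauss (R : comPzRingType) (q : R) n :
  let even m n := \prod_(m <= i < n) (1 - q ^+ (2 * i).+2) in
  let odds n := \prod_(0 <= i < n) (1 - q ^+ (2 * i).+1) in
  \sum_(s < n) even s n * odds s * q ^+ (s * (2 * n).+1) =
  odds n * \sum_(s < 2 * n) q ^+ tri s.
Proof.
move=> even odds.
have even_recl m k : (m < k)%N -> even m k = (1 - q ^+ (2 * m).+2) * even m.+1 k.
  by move=> lt_mk; rewrite /even big_ltn.
have even_recr m k : (m <= k)%N -> even m k.+1 = even m k * (1 - q ^+ (2 * k).+2).
  by move=> le_mk; rewrite /even big_nat_recr.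
have oddsS k : odds k.+1 = odds k * (1 - q ^+ (2 * k).+1).
  by rewrite /odds big_nat_recr.
elim: n => [|n IHn]; first by rewrite !big_ord0 mulr0.
have partial k : (k <= n)%N ->
  \sum_(s < k.+1) even s n.+1 * odds s * q ^+ (s * (2 * n.+1).+1) =
  (1 - q ^+ (2 * n).+1) * \sum_(s < k.+1) even s n * odds s * q ^+ (s * (2 * n).+1)
  + odds k.+1 * even k n * q ^+ (k.+1 * (2 * n).+1).
  elim: k => [|k IHk] le_kn.
    rewrite !big_ord1 /= even_recr // oddsS !mul0n mul1n muln0 exprS; ring.
  rewrite big_ord_recr [in RHS]big_ord_recr /= {}IHk; last exact: ltnW.
  rewrite even_recl // even_recr // (oddsS k.+1).
  have -> : (k.+1 * (2 * n.+1).+1 = (2 * k).+2 + k.+1 * (2 * n).+1)%N by lia.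
  have -> : (k.+2 * (2 * n).+1 = (2 * n).+1 + k.+1 * (2 * n).+1)%N by lia.
  have -> : (2 * k.+1).+1 = (2 * k).+3 by lia.
  by rewrite !exprD !exprS; ring.
rewrite partial // big_ord_recr /= mulrDr IHn.
have evennn : even n n = 1 by rewrite /even big_geq.
rewrite evennn mulr1 mul1r.
have -> : (2 * n.+1 = (2 * n).+2)%N by lia.
rewrite !big_ord_recr /= oddsS.
(* The term s = n and the boundary term of [partial] supply the two new powers of q on the right. *)
have -> : (tri (2 * n).+1 = n.+1 * (2 * n).+1)%N by have := tri2 (2 * n).+1; lia.
have -> : (tri (2 * n) = n * (2 * n).+1)%N by have := tri2 (2 * n); lia.
ring.
Qed.

(** * Generating functions *)

(** Congruence modulo X^N: polynomials stand for truncated power series. *)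
Definition eqmodXn {R : nzRingType} (N : nat) (p r : {poly R}) : Prop :=
  forall i, (i < N)%N -> p`_i = r`_i.

Section Truncation.

Variables (R : nzRingType) (N : nat).
Implicit Types p r : {poly R}.

Lemma eqmodXn_refl p : eqmodXn N p p.
Proof. by []. Qed.

Lemma eqmodXn_sym p r : eqmodXn N p r -> eqmodXn N r p.
Proof. by move=> eq_pr i /eq_pr. Qed.

Lemma eqmodXn_trans r p p' : eqmodXn N p r -> eqmodXn N r p' -> eqmodXn N p p'.
Proof. by move=> eq_pr eq_rp' i lt_iN; rewrite eq_pr ?eq_rp'. Qed.

Lemma eqmodXnM p p' r r' :
  eqmodXn N p p' -> eqmodXn N r r' -> eqmodXn N (p * r) (p' * r').
Proof.
move=> eq_p eq_r i lt_iN; rewrite !coefM; apply: eq_bigr => j _.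
by rewrite eq_p ?eq_r //; have := ltn_ord j; lia.
Qed.

Lemma eqmodXnMl p r r' : eqmodXn N r r' -> eqmodXn N (p * r) (p * r').
Proof. exact: eqmodXnM. Qed.

Lemma eqmodXnMr p r r' : eqmodXn N r r' -> eqmodXn N (r * p) (r' * p).
Proof. by move=> eq_r; exact: eqmodXnM. Qed.

Lemma eqmodXnX k p r : eqmodXn N p r -> eqmodXn N (p ^+ k) (r ^+ k).
Proof.
by move=> eq_pr; elim: k => [|k IHk]; rewrite ?expr0 // !exprS; exact: eqmodXnM.
Qed.

Lemma eqmodXn_deriv p r : eqmodXn N.+1 p r -> eqmodXn N p^`() r^`().
Proof. by move=> eq_pr i lt_iN; rewrite !coef_deriv eq_pr. Qed.

Lemma eqmodXn_leq M p r : (M <= N)%N -> eqmodXn N p r -> eqmodXn M p r.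
Proof. by move=> le_MN eq_pr i lt_iM; apply: eq_pr; exact: leq_trans le_MN. Qed.

Lemma eqmodXn_sum_high (I : finType) (F : I -> {poly R}) (e : I -> nat) p :
  (forall i, (N <= e i)%N) -> eqmodXn N (p + \sum_i F i * 'X^(e i)) p.
Proof.
move=> le_Ne k lt_kN; rewrite coefD coef_sum big1 ?addr0 // => i _.
by rewrite coefMXn (leq_trans lt_kN).
Qed.

End Truncation.

Definition pent_poly (R : nzRingType) (m : nat) : {poly R} :=
  1 + \sum_(s < m) (-1) ^+ s.+1 * ('X^(s.+1 * s.+1 + tri s.+1) +
                                   'X^(s.+1 * s + tri s.+1)).

Definition tri_poly (R : nzRingType) (d m : nat) : {poly R} :=
  \sum_(s < m) 'X^(d * tri s).

Definition part_poly (R : nzRingType) (N m : nat) : {poly R} :=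
  \poly_(i < N) (npart m i)%:R.

Section Series.

Variable R : comNzRingType.

(** In [shanks_pentagonal] every term with s >= 1 has exponent at least n + 1. *)
Lemma qprod_pent n : eqmodXn n.+1 (qprod {poly R} 'X 0 n) (pent_poly R n).
Proof.
rewrite /pent_poly -shanks_pentagonal big_ord_recl /= expr0 mul1r mulr1.
by apply: eqmodXn_sym; apply: eqmodXn_sum_high => i; rewrite /bump /= triS; lia.
Qed.

Lemma qprod_double n : eqmodXn n.+1 (qprod {poly R} 'X 0 (2 * n)) (qprod _ 'X 0 n).
Proof.
suff gen k : eqmodXn n.+1 (qprod {poly R} 'X 0 (n + k)) (qprod _ 'X 0 n).
  by rewrite mul2n -addnn.
elim: k => [|k IHk]; first by rewrite addn0; exact: eqmodXn_refl.
rewrite addnS qprod_recr //; apply: eqmodXn_trans IHk => i lt_in.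
by rewrite mulrBr mulr1 coefB coefMXn ltnS ifT ?subr0 //; lia.
Qed.

(** By [npartS], multiplying by 1 - X^(m+1) turns the series for parts at most m + 1 into the one
    for parts at most m. *)
Lemma part_poly_qprod N m :
  eqmodXn N (part_poly R N m * qprod _ 'X 0 m) 1.
Proof.
elim: m => [|m IHm].
  rewrite qprodnn mulr1 => i lt_iN; rewrite coef_poly lt_iN coef1 npart0.
  by case: eqP.
rewrite qprod_recr // mulrCA mulrC; apply: eqmodXn_trans IHm.
apply: eqmodXnMr => i lt_iN.
rewrite mulrBr mulr1 coefB coefMXn !coef_poly lt_iN npartS ltnS.
case: (ltnP m i) => [lt_mi|_]; last by rewrite addn0 subr0.
by rewrite ifT ?natrD ?addrK //; lia.
Qed.

End Series.

(** * Power series modulo 2 *)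

Section CharTwo.

Local Notation F2 := 'F_2.
Implicit Types p r : {poly F2}.

Lemma pchar_polyF2 : 2%N \in [pchar {poly F2}].
Proof. by rewrite pchar_lalg pchar_Fp. Qed.

Lemma natrF2 n : n%:R = (odd n)%:R :> F2.
Proof. by rewrite -(Fp_nat_mod (isT : prime 2)) modn2. Qed.

(** Frobenius is additive and fixes the coefficients in [F2], so squaring replaces X by X^2. *)
Lemma coef_sqr p n : (p ^+ 2)`_n = if odd n then 0 else p`_n./2.
Proof.
have sqrF2 (a : F2) : a ^+ 2 = a by apply/val_inj; case: a => [[|[]]].
rewrite -[p in LHS]coefK poly_def -(pFrobenius_autE pchar_polyF2) rmorph_sum /=.
rewrite coef_sum (eq_bigr (fun i : 'I_(size p) => p`_i * (n == i.*2)%:R)).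
  have [odd_n | even_n] := boolP (odd n).
    by rewrite big1 // => i _; case: eqP odd_n => [-> | _]; rewrite ?odd_double // mulr0.
  have [lt_n | le_n] := ltnP n./2 (size p).
    rewrite (bigD1 (Ordinal lt_n)) //= big1 ?addr0 => [|i ne_i].
      by rewrite even_halfK // eqxx mulr1.
    case: eqP => [def_n | _]; last by rewrite mulr0.
    by case/eqP: ne_i; apply: val_inj; rewrite /= def_n doubleK.
  rewrite nth_default // big1 // => i _; case: eqP => [def_n | _]; rewrite ?mulr0 //.
  by have := ltn_ord i; lia.
move=> i _; rewrite pFrobenius_autE exprZn -exprM sqrF2 coefZ coefXn.
by rewrite muln2.
Qed.

Lemma even_prod_qprod n :
  \prod_(0 <= i < n) (1 - 'X ^+ (2 * i).+2) = qprod {poly F2} 'X 0 n ^+ 2.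
Proof.
rewrite -prodrXl; apply: eq_bigr => i _.
rewrite -!(pFrobenius_autE pchar_polyF2) rmorphB rmorph1 /= pFrobenius_autE.
by rewrite -exprM; congr (1 - _ ^+ _); lia.
Qed.

Lemma qprod_split n :
  qprod {poly F2} 'X 0 (2 * n) =
  (\prod_(0 <= i < n) (1 - 'X ^+ (2 * i).+2)) * (\prod_(0 <= i < n) (1 - 'X ^+ (2 * i).+1)).
Proof.
elim: n => [|n IHn]; first by rewrite qprodnn !big_geq // mulr1.
have -> : (2 * n.+1 = (2 * n).+2)%N by lia.
by rewrite 2?qprod_recr // IHn !big_nat_recr //=; ring.
Qed.

(** Modulo 2 the even product is f^2, so Gauss's identity reads f^2 = [odds] * psi. Multiplying by
    f^2 and joining the even and odd products gives f^4 = f psi, and the partition series cancels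
    one f. *)
Lemma qprod_cube n : (0 < n)%N ->
  eqmodXn n.+1 (qprod {poly F2} 'X 0 n ^+ 3) (tri_poly F2 1 (2 * n)).
Proof.
move=> n_gt0; set f := qprod _ _ _ _; set psi := tri_poly _ _ _.
have gauss : eqmodXn n.+1 (f ^+ 2) (\prod_(0 <= i < n) (1 - 'X ^+ (2 * i).+1) * psi).
  case: n n_gt0 @f @psi => // n _ f psi.
  have -> : psi = \sum_(s < 2 * n.+1) 'X ^+ tri s.
    by apply: eq_bigr => s _; rewrite mul1n.
  rewrite -(shanks_gauss _ 'X n.+1) big_ord_recl /= -even_prod_qprod.
  apply: eqmodXn_sym; rewrite [X in X + _](_ : _ = f ^+ 2); last first.
    by rewrite even_prod_qprod big_geq // mulr1 mul0n expr0 mulr1.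
  rewrite even_prod_qprod.
  by apply: eqmodXn_sum_high => i; rewrite /bump /=; lia.
have fpsi : eqmodXn n.+1 (f ^+ 4) (f * psi).
  rewrite (_ : f ^+ 4 = f ^+ 2 * f ^+ 2); last by ring.
  apply: eqmodXn_trans (eqmodXnMl _ _ (f ^+ 2) _ _ gauss) _.
  rewrite mulrA -even_prod_qprod -qprod_split.
  exact: eqmodXnMr (qprod_double _ n).
have inv_f := part_poly_qprod F2 n.+1 n; rewrite -/f in inv_f.
apply: eqmodXn_trans (_ : eqmodXn _ _ (part_poly F2 n.+1 n * f ^+ 4)) _.
  rewrite (exprS f 3) mulrA -[X in eqmodXn _ X _]mul1r; apply: eqmodXnMr.
  exact: eqmodXn_sym.
apply: eqmodXn_trans (eqmodXnMl _ _ _ _ _ fpsi) _.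
by rewrite mulrA -[X in eqmodXn _ _ X]mul1r; exact: eqmodXnMr.
Qed.

Lemma coef_tri_poly_mul m i :
  (tri_poly F2 1 m * tri_poly F2 7 m)`_i = (size (tri_reps m i))%:R.
Proof.
rewrite /tri_poly big_distrlr /= coef_sum /tri_reps size_filter -sumn_count sumnE.
rewrite big_map big_allpairs natr_sum.
have -> : iota 0 m = index_iota 0 m by rewrite /index_iota subn0.
rewrite big_mkord; apply: eq_bigr => a _; rewrite coef_sum big_mkord natr_sum.
by apply: eq_bigr => b _; rewrite -exprD coefXn mul1n eq_sym.
Qed.

(** For odd i both coefficients vanish; for even i, [size_tri_reps_double] equates those of [ww] at
    i + 1 and i/2. *)
Lemma deriv_tri_poly_mul K (ww := tri_poly F2 1 (2 * K) * tri_poly F2 7 (2 * K)) :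
  eqmodXn K ww^`() (ww ^+ 2).
Proof.
move=> i lt_iK; rewrite coef_deriv coef_sqr; case: ifP => [odd_i | /negbT even_i].
  by rewrite -mulr_natr natrF2 /= odd_i mulr0.
rewrite -mulr_natr natrF2 /= even_i mulr1.
rewrite !coef_tri_poly_mul; congr _%:R; rewrite -(size_tri_reps_double _ i./2); last by lia.
by congr (size (tri_reps _ _)); lia.
Qed.

Lemma coef_p77 K n : (0 < K)%N -> (n <= K)%N ->
  (part_poly F2 K.+1 K * tri_poly F2 7 (2 * K))`_n = (p77 n)%:R.
Proof.
move=> K_gt0 le_nK; rewrite natrF2 (odd_p77 n (2 * K)); last by lia.
rewrite -natrF2 natr_sum [RHS]big_mkcond.
rewrite /tri_poly mulr_sumr coef_sum; apply: eq_bigr => j _ /=.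
rewrite coefMXn ltnNge; case: leqP => //= le_n.
by rewrite coef_poly ltnS ifT ?npart_geq //; lia.
Qed.

(** Since f^4 has derivative 0, f^4 G' = (psi psi7)' = (psi psi7)^2 = f^4 (f psi7)^2. Multiplying by
    P^4 cancels f^4, and f is then replaced by the pentagonal series. *)
Lemma deriv_p77 K : (0 < K)%N ->
  eqmodXn K (part_poly F2 K.+1 K * tri_poly F2 7 (2 * K))^`()
            ((pent_poly F2 K * tri_poly F2 7 (2 * K)) ^+ 2).
Proof.
move=> K_gt0; set P := part_poly _ _ _; set psi7 := tri_poly _ _ _.
set G := P * psi7; pose f := qprod {poly F2} 'X 0 K; pose psi := tri_poly F2 1 (2 * K).
have inv_f : eqmodXn K.+1 (P * f) 1 := part_poly_qprod F2 K.+1 K.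
have cube_f : eqmodXn K.+1 (f ^+ 3) psi := qprod_cube K K_gt0.
have prod_G : eqmodXn K.+1 (f ^+ 4 * G) (psi * psi7).
  rewrite (_ : f ^+ 4 * G = (P * f) * (f ^+ 3 * psi7)); last by rewrite /G; ring.
  rewrite -[X in eqmodXn _ _ X]mul1r; apply: eqmodXnM => //; exact: eqmodXnMr.
have deriv_G : eqmodXn K (f ^+ 4 * G^`()) (f ^+ 4 * (f * psi7) ^+ 2).
  have -> : f ^+ 4 * G^`() = (f ^+ 4 * G)^`().
    by rewrite [RHS]derivM deriv_exp -[X in X * G]mulr_natr -(GRing.natr_mod_pchar pchar_polyF2 4) !(mulr0, mul0r) add0r.
  apply: eqmodXn_trans (eqmodXn_deriv _ _ _ _ prod_G) _.
  apply: eqmodXn_trans (deriv_tri_poly_mul K) _.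
  rewrite (_ : f ^+ 4 * _ = (f ^+ 3 * psi7) ^+ 2); last by ring.
  apply: eqmodXn_sym; apply: eqmodXnX; apply: eqmodXnMr.
  exact: eqmodXn_leq cube_f.
have inv_f4 : eqmodXn K (P ^+ 4 * f ^+ 4) 1.
  by rewrite -exprMn -(expr1n _ 4); apply: eqmodXnX; exact: eqmodXn_leq inv_f.
have cancel_f r : eqmodXn K (P ^+ 4 * (f ^+ 4 * r)) r.
  by rewrite mulrA -[X in eqmodXn _ _ X]mul1r; exact: eqmodXnMr.
apply: eqmodXn_trans (eqmodXn_sym _ _ _ _ (cancel_f _)) _.
apply: eqmodXn_trans (eqmodXnMl _ _ _ _ _ deriv_G) _.
apply: eqmodXn_trans (cancel_f _) _.
apply: eqmodXnX; apply: eqmodXnMr; exact: eqmodXn_leq (qprod_pent _ _).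
Qed.

End CharTwo.

Local Close Scope ring_scope.

(** * The congruences *)

Lemma sumr_neq0 (V : zmodType) (I : finType) (F : I -> V) :
  (\sum_i F i != 0)%R -> exists i, (F i != 0)%R.
Proof.
move=> nz; apply/existsP; apply: contraNT nz => /existsPn all0.
by rewrite big1 // => i _; apply/eqP; have := all0 i; rewrite negbK.
Qed.

(** Completing the square: 24 k(3k +- 1)/2 + 1 = (6k +- 1)^2. *)
Lemma coef_pent_poly (R : nzRingType) m i :
  ((pent_poly R m)`_i != 0)%R -> exists x, 24 * i + 1 = x ^ 2.
Proof.
rewrite /pent_poly coefD coef1; have [-> | i_neq0] := eqVneq i 0; first by exists 1.
rewrite add0r coef_sum => /sumr_neq0[s].
have tri_s := tri2 s.+1.
rewrite -signr_odd mulr_sign.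
have [-> | ne1] := eqVneq i (s.+1 * s.+1 + tri s.+1).
  by exists (6 * s.+1 + 1); nia.
have [-> | ne2] := eqVneq i (s.+1 * s + tri s.+1).
  by exists (6 * s.+1 - 1); nia.
by case: odd; rewrite ?coefN coefD !coefXn (negPf ne1) (negPf ne2) ?oppr0 addr0 ?oppr0 eqxx.
Qed.

Lemma coef_tri_poly (R : nzRingType) d m i :
  ((tri_poly R d m)`_i != 0)%R -> exists y, 8 * i + d = d * y ^ 2.
Proof.
rewrite /tri_poly coef_sum => /sumr_neq0[s]; rewrite coefXn.
have [-> _ | _] := eqVneq i (d * tri s); last by rewrite eqxx.
by exists (2 * s + 1); have := tri2 s; nia.
Qed.

Lemma odd_p77_double_rep n :
  odd (p77 (2 * n + 1)) -> exists x y, 24 * n + 22 = x ^ 2 + 21 * y ^ 2.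
Proof.
move=> odd_p; pose K := 2 * n + 1; have K_gt0 : 0 < K by rewrite /K addn1.
have : ((pent_poly 'F_2 K * tri_poly 'F_2 7 (2 * K))`_n != 0)%R.
  (* Compare coefficients of X^(2n): on the left (2n + 1) [p77 (2 * n + 1)], on the right the
     coefficient of X^n in the unsquared series. *)
  have := deriv_p77 K K_gt0 (2 * n); rewrite coef_sqr mul2n odd_double doubleK.
  move=> <-; last by lia.
  rewrite coef_deriv coef_p77 //; last by lia.
  rewrite -[X in (X != _)%R]mulr_natr natrF2 [X in (_ * X)%R]natrF2.
  by move: odd_p; rewrite addn1 mul2n => ->; rewrite /= odd_double.
rewrite coefM => /sumr_neq0[j]; rewrite mulf_eq0 => /norP[/coef_pent_poly[x def_x] /coef_tri_poly[y def_y]].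
by exists x, y; have := ltn_ord j; nia.
Qed.

(** * The form x^2 + 21 y^2 modulo powers of 7 *)

(** If 49 divides the value, then 7 divides x, hence 3 y^2, hence y, and 49 can be divided out. *)
Lemma norm21_descent k u x y :
  x ^ 2 + 21 * y ^ 2 = 49 ^ k * u ->
  exists x' y', x' ^ 2 + 21 * y' ^ 2 = u.
Proof.
elim: k x y => [|k IHk] x y; first by rewrite mul1n; exists x, y.
rewrite (expnS 49) -mulnA => def_u.
have /dvdnP[x1 def_x] : 7 %| x.
  have : 7 %| x ^ 2 by apply/dvdnP; exists (7 * (49 ^ k * u) - 3 * y ^ 2); lia.
  by rewrite Euclid_dvdX // andbT.
have /dvdnP[y1 def_y] : 7 %| y.
  have : 7 %| 3 * y ^ 2.
    by apply/dvdnP; exists (49 ^ k * u - x1 ^ 2); rewrite def_x in def_u; nia.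
  by rewrite Euclid_dvdM // Euclid_dvdX // andbT.
by apply: (IHk x1 y1); rewrite def_x def_y in def_u; nia.
Qed.

Lemma sqr_mod7 x : x ^ 2 %% 7 \in [:: 0; 1; 2; 4].
Proof.
rewrite -modnXm; have : x %% 7 < 7 by rewrite ltn_mod.
by case: (x %% 7) => [|[|[|[|[|[|[|]]]]]]].
Qed.

(** Modulo 7 the form is x^2, while 3, 5, 6 are the nonresidues. *)
Lemma norm21_nonresidue u x y : u %% 7 \in [:: 3; 5; 6] -> x ^ 2 + 21 * y ^ 2 <> u.
Proof.
move=> u7 def_u; have := sqr_mod7 x.
have -> : x ^ 2 %% 7 = u %% 7 by rewrite -def_u; lia.
by move: u7; rewrite !inE => /or3P[] /eqP->.
Qed.

(** Here 7 divides x, and dividing by 7 leaves u = 3 y^2 modulo 7. As 3 is a nonresidue, u cannot be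
    a nonzero square. *)
Lemma norm21_residue u x y : u %% 7 \in [:: 1; 2; 4] -> x ^ 2 + 21 * y ^ 2 <> 7 * u.
Proof.
move=> u7 def_u.
have /dvdnP[x1 def_x] : 7 %| x.
  have : 7 %| x ^ 2 by apply/dvdnP; exists (u - 3 * y ^ 2); lia.
  by rewrite Euclid_dvdX // andbT.
have {def_x}def_u : 7 * x1 ^ 2 + 3 * y ^ 2 = u by rewrite def_x in def_u; nia.
have := sqr_mod7 y; have : u %% 7 = 3 * (y ^ 2 %% 7) %% 7 by rewrite -def_u; lia.
move: u7; rewrite !inE => /or3P[] /eqP-> => e /or4P[] /eqP; lia.
Qed.

Lemma p77_odd_even N : (forall x y, x ^ 2 + 21 * y ^ 2 <> 2 * (6 * N + 5)) ->
  odd N -> p77 N = 0 %[mod 2].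
Proof.
move=> no_rep odd_N; rewrite mod0n modn2; case: (boolP (odd (p77 N))) => // odd_p.
have def_N : N = 2 * N./2 + 1 by lia.
rewrite def_N in odd_p; have [x [y def_xy]] := odd_p77_double_rep _ odd_p.
by case: (no_rep x y); lia.
Qed.

Theorem theorem3p9 (alpha n : nat) :
  (forall r : nat, r \in [:: 3; 4; 6] ->
     p77 (2 * 7 ^ (2 * alpha + 1) * n
          + ((11 + 12 * r) * 49 ^ alpha - 5) %/ 6) = 0 %[mod 2])
  /\
  (forall s : nat, s \in [:: 2; 4; 5] ->
     p77 (2 * 49 ^ (alpha + 1) * n
          + ((12 * s + 5) * 7 ^ (2 * alpha + 1) - 5) %/ 6) = 0 %[mod 2]).
Proof.
(* Since 49^alpha is 1 modulo 12, both divisions by 6 are exact and both arguments are odd. *)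
have [k pow49] : exists k, 49 ^ alpha = 12 * k + 1.
  elim: alpha => [|a [k IHa]]; first by exists 0.
  by exists (49 * k + 4); rewrite expnS IHa; lia.
rewrite !addn1 !expnS expnM -[7 ^ 2]/49; split=> [r r_in | s s_in].
  set N := (X in p77 X).
  have def_N : 6 * N + 5 = 49 ^ alpha * (84 * n + 12 * r + 11).
    by rewrite /N pow49; lia.
  apply: p77_odd_even => [x y|]; last by rewrite /N pow49; lia.
  rewrite def_N mulnCA => /norm21_descent[x' [y']]; apply: norm21_nonresidue.
  (* 2 (84n + 12r + 11) = 3r + 1 modulo 7, which is 3, 6, 5 for r = 3, 4, 6. *)
  by move: r_in; rewrite !inE => /or3P[] /eqP->; lia.
set N := (X in p77 X).
have def_N : 6 * N + 5 = 49 ^ alpha * (7 * (84 * n + 12 * s + 5)).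
  by rewrite /N pow49; lia.
apply: p77_odd_even => [x y|]; last by rewrite /N pow49; lia.
rewrite def_N !(mulnCA 2) => /norm21_descent[x' [y']]; apply: norm21_residue.
(* 2 (84n + 12s + 5) = 3s + 3 modulo 7, which is 2, 1, 4 for s = 2, 4, 5. *)
by move: s_in; rewrite !inE => /or3P[] /eqP->; lia.
Qed.
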